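(* Fix $c>0$ and one of the six models. For every $N$ and every $1\le N_1,N_2\le N-1$ with $N_1+N_2=N$, $$\mathbb{E}\big[H(\mathbb{G}(N,\lfloor cN\rfloor))\big]\ge\mathbb{E}\big[H(\mathbb{G}(N_1,\mathcal{M}_1))\big]+\mathbb{E}\big[H(\mathbb{G}(N_2,\mathcal{M}_2))\big],$$ where $\mathcal{M}_1\sim\mathrm{Bi}(\lfloor cN\rfloor,N_1/N)$ and $\mathcal{M}_2=\lfloor cN\rfloor-\mathcal{M}_1\sim\mathrm{Bi}(\lfloor cN\rfloor,N_2/N)$. Additionally, for the Coloring, K-SAT and NAE-K-SAT models, $$p(N,\lfloor cN\rfloor)\ge\mathbb{P}\Big(H\big(\mathbb{G}(N_1,\mathcal{M}_1)\oplus\mathbb{G}(N_2,\mathcal{M}_2)\big)=\mathcal{M}_1+\mathcal{M}_2\Big),$$ where $\oplus$ denotes disjoint union, $\mathbb{G}(N_1,\mathcal{M}_1)$ lives on nodes $\{1,\dots,N_1\}$ and $\mathbb{G}(N_2,\mathcal{M}_2)$ on nodes $\{N_1+1,\dots,N\}$, and given $\mathcal{M}_1$ the two graphs (with their potentials) are generated independently.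
   Context: Let $K\ge2$, $\chi=\{0,\dots,q-1\}$. $\mathbb{G}(n,m)$ on an $n$-element node set $V$: $m$ directed hyperedges chosen independently and uniformly at random from $V^K$. For a hypergraph $G=(V,E)$ with node potentials $H_i$ and edge potentials $H_e:\chi^K\to\mathbb{R}\cup\{-\infty\}$, $H(x)=\sum_{i}H_i(x_i)+\sum_{e\in E}H_e(x_e)$ for $x\in\chi^V$, and $H(G)=\max_xH(x)$. Models: Independent set ($K=2,q=2$, $H_i(1)=1,H_i(0)=0$, $H_e(1,1)=-\infty$, else $0$); MAX-CUT ($K=2,q=2$, $H_i\equiv0$, $H_e(x,y)=\mathbf 1[x\ne y]$); anti-ferromagnetic Ising ($K=2,q=2$, fixed $\beta>0,B\in\mathbb{R}$, $H_i(0)=-B,H_i(1)=B$, $H_e(x,y)=-\beta$ if $x=y$, $\beta$ otherwise); $q$-Coloring ($K=2$, $H_i\equiv0$, $H_e(x,y)=\mathbf 1[x\ne y]$); K-SAT ($q=2$, $H_i\equiv0$, independent uniform $a_e\in\{0,1\}^K$ per hyperedge, $H_e(a_e)=0$, $1$ otherwise); NAE-K-SAT ($H_e(a_e)=H_e(\mathbf1-a_e)=0$, $1$ otherwise). $p(N,M)=\mathbb{P}(H(\mathbb{G}(N,M))=M)$. $\mathrm{Bi}(n,\theta)$ is the binomial distribution. *)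

(* Defs.v *)
From HB Require Import structures.
From mathcomp Require Import all_boot all_order all_algebra.
From mathcomp Require Import reals constructive_ereal.
Set Implicit Arguments. Unset Strict Implicit. Unset Printing Implicit Defensive.
Import Order.TTheory GRing.Theory Num.Theory.
Local Open Scope ring_scope.

(* A model: arity K, alphabet chi = 'I_q, a finite type L of per-edge random
   labels (unit for models without random signs; {0,1}^K for (NAE-)K-SAT),
   node potential H_i and edge potential H_e (possibly -oo). *)
Record model (R : realType) := Model {
  mK : nat;
  mq : nat;
  mL : finType;
  hnode : 'I_mq -> R;
  hedge : mL -> mK.-tuple 'I_mq -> \bar R }.

Inductive kind (R : realType) :=
| IndSet | MaxCut | Ising of R & R
| Coloring of nat (* q *) | KSAT of nat (* K *) | NAESAT of nat (* K *).

Definition kind_ok (R : realType) (k : kind R) : Prop :=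
  match k with
  | Ising beta _ => 0 < beta
  | Coloring q => (2 <= q)%N
  | KSAT K => (2 <= K)%N
  | NAESAT K => (2 <= K)%N
  | _ => True
  end.

Definition is_csp (R : realType) (k : kind R) : bool :=
  match k with Coloring _ | KSAT _ | NAESAT _ => true | _ => false end.

Definition x0 {n} (t : 2.-tuple 'I_n) := tnth t ord0.
Definition x1 {n} (t : 2.-tuple 'I_n) := tnth t ord_max.

Definition model_of (R : realType) (k : kind R) : model R :=
  match k with
  | IndSet => @Model R 2 2 unit (fun i => (val i)%:R)
      (fun _ t => if (val (x0 t) == 1%N) && (val (x1 t) == 1%N) then -oo%E else 0%E)
  | MaxCut => @Model R 2 2 unit (fun _ => 0)
      (fun _ t => ((x0 t != x1 t)%:R)%:E)
  | Ising beta B => @Model R 2 2 unit (fun i => if val i == 1%N then B else - B)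
      (fun _ t => (if x0 t == x1 t then - beta else beta)%:E)
  | Coloring q => @Model R 2 q unit (fun _ => 0)
      (fun _ t => ((x0 t != x1 t)%:R)%:E)
  | KSAT K => @Model R K 2 (K.-tuple 'I_2) (fun _ => 0)
      (fun a t => if t == a then 0%E else 1%E)
  | NAESAT K => @Model R K 2 (K.-tuple 'I_2) (fun _ => 0)
      (fun a t => if (t == a) || (t == map_tuple (@rev_ord 2) a) then 0%E else 1%E)
  end.

(* A (labelled, directed) hypergraph with n nodes 'I_n and m hyperedges:
   the m hyperedges in V^K together with their random labels. *)
Definition graph (R : realType) (Md : model R) (n m : nat) : finType :=
  (m.-tuple ((mK Md).-tuple 'I_n) * m.-tuple (mL Md))%type.

Local Open Scope ereal_scope.

Definition Hx (R : realType) (Md : model R) (n m : nat) (G : graph Md n m)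
  (x : {ffun 'I_n -> 'I_(mq Md)}) : \bar R :=
  (\sum_(i < n) (hnode (x i))%:E) +
  \sum_(e < m) hedge (tnth G.2 e) (map_tuple x (tnth G.1 e)).

Definition HG (R : realType) (Md : model R) (n m : nat) (G : graph Md n m) : \bar R :=
  \big[maxe/-oo]_(x : {ffun 'I_n -> 'I_(mq Md)}) Hx G x.

(* E[H(G(n,m))]: G uniform over graph Md n m (m iid uniform hyperedges in V^K,
   with iid uniform labels) *)
Definition EH (R : realType) (Md : model R) (n m : nat) : \bar R :=
  \sum_(G : graph Md n m) ((#|graph Md n m|%:R)^-1)%:E * HG G.

Local Close Scope ereal_scope.

Definition psat (R : realType) (Md : model R) (n m : nat) : R :=
  (#|[set G : graph Md n m | HG G == (m%:R)%:E]|%:R) / (#|graph Md n m|%:R).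

Definition binp (R : realType) (M : nat) (theta : R) (k : nat) : R :=
  ('C(M, k))%:R * theta ^+ k * (1 - theta) ^+ (M - k).

Definition gunion (R : realType) (Md : model R) (n1 n2 m1 m2 : nat)
  (G1 : graph Md n1 m1) (G2 : graph Md n2 m2) : graph Md (n1 + n2) (m1 + m2) :=
  (cat_tuple (map_tuple (map_tuple (@lshift n1 n2)) G1.1)
             (map_tuple (map_tuple (@rshift n1 n2)) G2.1),
   cat_tuple G1.2 G2.2).

Definition punion (R : realType) (Md : model R) (n1 n2 m1 m2 : nat) : R :=
  (#|[set G : graph Md n1 m1 * graph Md n2 m2 |
       HG (gunion G.1 G.2) == ((m1 + m2)%N%:R)%:E]|%:R)
  / (#|graph Md n1 m1|%:R * #|graph Md n2 m2|%:R).

(* Main.v *)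
(** Start from M uniform hyperedges on V^K and replace them one at a time by
hyperedges that fall in V1^K with probability N1/N and in V2^K otherwise; after
M replacements the graph is the disjoint union with a binomial number of edges
on each side.  As edges commute, it suffices that one replacement, the other
edges being fixed, does not increase the expected value.

In every model an edge potential is a constant minus a nonnegative multiple of
the indicator that the edge is violated.  The basic quantity is thus the
probability that a random edge is violated by all assignments of a set S.  The
assignments of S partition the nodes (equal values, frozen nodes, ...), and
averaging over the labels turns this probability into a nonnegative combination
of terms (|C|/N)^K, with C a set of nodes; by convexity of t^K it does not
decrease under the replacement.  The maximum of H is a constant minus a
nonnegative combination of such indicators, S ranging over the superlevel sets
of the current H, and satisfiability is the case of a single S. *)
Require Import Defs.
From HB Require Import structures.
From mathcomp Require Import all_boot all_order all_algebra.
From mathcomp Require Import reals constructive_ereal.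
From mathcomp Require Import ring lra.
Set Implicit Arguments. Unset Strict Implicit. Unset Printing Implicit Defensive.
Import Order.TTheory GRing.Theory Num.Theory.
Local Open Scope ring_scope.

(** * Uniform averages over finite types, products and tuples *)

Section Averages.
Variable R : realType.

Definition avg (T : finType) (F : T -> R) : R := (\sum_t F t) / #|T|%:R.

Lemma eq_avg (T : finType) (F G : T -> R) : F =1 G -> avg F = avg G.
Proof. by move=> FG; rewrite /avg (eq_bigr G). Qed.

Lemma ler_avg (T : finType) (F G : T -> R) :
  (forall t, F t <= G t) -> avg F <= avg G.
Proof. by move=> FG; rewrite ler_wpM2r ?invr_ge0 ?ler0n// ler_sum. Qed.

Lemma avgD (T : finType) (F G : T -> R) :
  avg (fun t => F t + G t) = avg F + avg G.
Proof. by rewrite /avg big_split mulrDl. Qed.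

Lemma avgZ (T : finType) a (F : T -> R) :
  avg (fun t => a * F t) = a * avg F.
Proof. by rewrite /avg -mulr_sumr mulrA. Qed.

Lemma avg_cst (T : finType) (a : R) : (0 < #|T|)%N -> avg (fun _ : T => a) = a.
Proof.
by move=> T0; rewrite /avg sumr_const -[a *+ _]mulr_natr mulfK// pnatr_eq0 -lt0n.
Qed.

Lemma avg_sum (T : finType) (I : Type) (r : seq I) (F : I -> T -> R) :
  avg (fun t => \sum_(i <- r) F i t) = \sum_(i <- r) avg (F i).
Proof. by rewrite /avg exchange_big mulr_suml. Qed.

Lemma avg_exchange (T U : finType) (F : T -> U -> R) :
  avg (fun t => avg (F t)) = avg (fun u => avg (F^~ u)).
Proof.
rewrite /avg -!mulr_suml exchange_big/=.
by rewrite -mulrA [_^-1 * _]mulrC mulrA.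
Qed.

Lemma avg_prod (T U : finType) (F : T * U -> R) :
  avg F = avg (fun t => avg (fun u => F (t, u))).
Proof.
rewrite /avg -mulr_suml -mulrA -invfM -natrM mulnC -card_prod; congr (_ / _).
by rewrite pair_bigA; apply: eq_bigr => -[].
Qed.

Lemma avg_tuple0 (T : finType) (F : 0.-tuple T -> R) : avg F = F [tuple].
Proof.
rewrite /avg card_tuple expn0 divr1 (big_pred1 [tuple])// => t.
by rewrite [t]tuple0; apply/esym/eqP.
Qed.

Lemma sum_tupleS (V : nmodType) (T : finType) m (F : m.+1.-tuple T -> V) :
  \sum_t F t = \sum_a \sum_(t : m.-tuple T) F [tuple of a :: t].
Proof.
rewrite pair_bigA/= (reindex (fun p : T * m.-tuple T => [tuple of p.1 :: p.2]))//.
exists (fun t => (thead t, [tuple of behead t])) => [[a t] _|t _] /=.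
  by rewrite theadE; congr pair; apply: val_inj.
by rewrite -tuple_eta.
Qed.

Lemma avg_tupleS (T : finType) m (F : m.+1.-tuple T -> R) :
  avg F = avg (fun a => avg (fun t : m.-tuple T => F [tuple of a :: t])).
Proof.
rewrite /avg sum_tupleS -mulr_suml -mulrA -invfM -natrM.
by rewrite !card_tuple expnSr.
Qed.

Lemma sum_tuple_prod (T : finType) (f : T -> R) m :
  \sum_(t : m.-tuple T) \prod_(j < m) f (tnth t j) = (\sum_a f a) ^+ m.
Proof.
elim: m => [|m IHm].
  rewrite (big_pred1 [tuple]) ?big_ord0// => t.
  by rewrite [t]tuple0; apply/esym/eqP.
rewrite sum_tupleS exprS mulr_suml; apply: eq_bigr => a _.
rewrite -IHm mulr_sumr; apply: eq_bigr => t _.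
by rewrite big_ord_recl tnth0; congr (_ * _); apply: eq_bigr => j _; rewrite tnthS.
Qed.

End Averages.

(** * Replacing random edges one at a time *)

Section Interpolation.
Variables (R : realType) (St E : Type) (add : St -> E -> St).
Hypothesis addAC : forall s e f, add (add s e) f = add (add s f) e.

(** The averaging operator on observables given by adding one random edge. The state type stays
    abstract because two summaries of a graph are used: a vector of weights for the expected
    maximum, a set of assignments for satisfiability. *)
Definition step (T : finType) (i : T -> E) (phi : St -> R) (s : St) : R :=
  avg (fun t => phi (add s (i t))).

Lemma eq_step (T : finType) (i : T -> E) phi psi :
  phi =1 psi -> step i phi =1 step i psi.
Proof. by move=> e s; apply: eq_avg => t; apply: e. Qed.

Lemma ler_iter_step (T : finType) (i : T -> E) m phi psi :
  (forall s, phi s <= psi s) ->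
  forall s, iter m (step i) phi s <= iter m (step i) psi s.
Proof. by move=> e; elim: m => //= m IHm s; apply: ler_avg => t. Qed.

Lemma step_lin (T I : finType) (i : T -> E) (c : I -> R) (F : I -> St -> R) s :
  step i (fun s => \sum_m c m * F m s) s = \sum_m c m * step i (F m) s.
Proof. by rewrite /step avg_sum; apply: eq_bigr => m _; rewrite avgZ. Qed.

Lemma step_comm (T U : finType) (i : T -> E) (j : U -> E) phi s :
  step i (step j phi) s = step j (step i phi) s.
Proof.
rewrite /step avg_exchange; apply: eq_avg => u; apply: eq_avg => t.
by rewrite addAC.
Qed.

Lemma iter_step_comm (T U : finType) (i : T -> E) (j : U -> E) m phi s :
  iter m (step i) (step j phi) s = step j (iter m (step i) phi) s.
Proof.
elim: m s => //= m IHm s; rewrite (eq_step _ IHm); exact: step_comm.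
Qed.

(** Iterating the operator amounts to drawing all edges at once. Endpoints and labels occupy
    separate tuples, to match the layout of [graph]. *)
Lemma iter_step (T U : finType) (i : T * U -> E) m phi s :
  iter m (step i) phi s =
  avg (fun G : m.-tuple T * m.-tuple U => phi (foldl add s (map i (zip G.1 G.2)))).
Proof.
elim: m s => [|m IHm] s; rewrite avg_prod.
  by rewrite !avg_tuple0.
rewrite avg_tupleS /= /step avg_prod; apply: eq_avg => a.
under [RHS]eq_avg do rewrite avg_tupleS.
rewrite avg_exchange; apply: eq_avg => b.
by rewrite IHm avg_prod.
Qed.

Variables (T T1 T2 : finType) (i : T -> E) (i1 : T1 -> E) (i2 : T2 -> E).
Variable theta : R.
Hypothesis theta01 : 0 <= theta <= 1.

Definition mix (phi : St -> R) (s : St) : R :=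
  theta * step i1 phi s + (1 - theta) * step i2 phi s.

Lemma eq_mix phi psi : phi =1 psi -> mix phi =1 mix psi.
Proof. by move=> e s; rewrite /mix !(eq_step _ e). Qed.

Lemma ler_mix phi psi :
  (forall s, phi s <= psi s) -> forall s, mix phi s <= mix psi s.
Proof.
case/andP: theta01 => t0 t1 e s.
by apply: lerD; apply: ler_wpM2l; rewrite ?subr_ge0//; apply: ler_avg.
Qed.

Lemma iter_step_mix m phi s :
  iter m (step i) (mix phi) s = mix (iter m (step i) phi) s.
Proof.
elim: m s => // m IHm s; rewrite iterS (eq_step _ IHm) {1}/step avgD !avgZ /mix /=.
by congr (_ * _ + _ * _); exact: step_comm.
Qed.

(** One replacement at a time: [mix] to the power M+1 is at most [mix] after M uniform steps. Since
    edges commute, that [mix] can be moved next to [phi], so the one-edge hypothesis is only ever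
    used for [phi] itself. *)
Lemma iter_mix_le M phi :
  (forall s, mix phi s <= step i phi s) ->
  forall s, iter M mix phi s <= iter M (step i) phi s.
Proof.
move=> le; elim: M => // M IHM s; rewrite iterS.
apply: le_trans (ler_mix IHM s) _; rewrite -iter_step_mix iterSr.
exact: ler_iter_step.
Qed.

Lemma pascal_sum (M : nat) (t u : R) (g : nat -> R) :
  \sum_(m < M.+1) ('C(M, m))%:R * t ^+ m * u ^+ (M - m) * (t * g m.+1 + u * g m)
  = \sum_(m < M.+2) ('C(M.+1, m))%:R * t ^+ m * u ^+ (M.+1 - m) * g m.
Proof.
rewrite [RHS]big_ord_recl/=.
under [in RHS]eq_bigr => m _ do
  rewrite /bump leq0n add1n binS natrD subSS !mulrDl.
rewrite big_split/= addrA.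
under eq_bigr do rewrite mulrDr.
rewrite big_split/= addrC; congr (_ + _); last first.
  by apply: eq_bigr => m _; rewrite exprS; ring.
rewrite [X in _ + X]big_ord_recr/=.
rewrite (bin_small (ltnSn M)) !mul0r addr0.
rewrite big_ord_recl/=; congr (_ + _).
  by rewrite !bin0 !subn0 exprS; ring.
apply: eq_bigr => m _; rewrite /bump leq0n add1n.
by rewrite -[in RHS](subnSK (ltn_ord m)) (exprS u); ring.
Qed.

(** The binomial theorem for the commuting operators [step i1] and [step i2]; the induction step is
    Pascal's rule, in the form of [pascal_sum]. *)
Lemma iter_mix M phi s :
  iter M mix phi s = \sum_(m < M.+1)
    binp M theta m * iter m (step i1) (iter (M - m) (step i2) phi) s.
Proof.
elim: M s => [|M IHM] s.
  by rewrite big_ord1 /binp bin0 !expr0 !mul1r.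
rewrite iterS (eq_mix IHM) /binp.
rewrite -(pascal_sum M theta (1 - theta)
  (fun m => iter m (step i1) (iter (M.+1 - m) (step i2) phi) s)).
rewrite /mix !step_lin !mulr_sumr -big_split/=; apply: eq_bigr => m _.
rewrite -[step i2 _ s]iter_step_comm (subSn (leq_ord m)) /=; ring.
Qed.

End Interpolation.

(** * The maximum as a combination of indicators of violation *)

Section Maximum.
Variable R : realType.

Lemma bigmaxe_eq (X : finType) (w : X -> \bar R) r x :
  (forall y, (w y <= r)%E) -> w x = r -> \big[maxe/-oo%E]_y w y = r.
Proof.
move=> le wx; apply/le_anti/andP; split.
  by apply: bigmax_le => [|y _]; rewrite ?leNye.
by rewrite -wx; apply: le_bigmax.
Qed.

(** The value is meaningful only for inhabited [X]; otherwise [fine] turns -oo into a default. *)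
Definition maxR (X : finType) (w : X -> R) : R :=
  fine (\big[maxe/-oo%E]_x (w x)%:E).

Lemma maxR_eq (X : finType) (w : X -> R) r x :
  (forall y, w y <= r) -> w x = r -> maxR w = r.
Proof.
by move=> le wx; rewrite /maxR (bigmaxe_eq (r := r%:E) (x := x)) ?wx// => y; rewrite lee_fin.
Qed.

Lemma maxRP (X : finType) (w : X -> R) (x : X) :
  exists2 y, maxR w = w y & forall z, w z <= maxR w.
Proof.
pose y := [arg max_(y > x) w y]%O.
have le z : w z <= w y by rewrite /y; case: arg_maxP => // i _; apply.
by exists y; rewrite (maxR_eq le erefl).
Qed.

Lemma eq_maxR (X : finType) (w w' : X -> R) : w =1 w' -> maxR w = maxR w'.
Proof. by move=> e; rewrite /maxR; congr fine; apply: eq_bigr => x _; rewrite e. Qed.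

Lemma bigmaxe_maxR (X : finType) (w : X -> R) (x : X) :
  \big[maxe/-oo%E]_y (w y)%:E = (maxR w)%:E.
Proof.
have [y e le] := maxRP w x.
by apply: (bigmaxe_eq (x := y)) => [z|]; rewrite ?lee_fin// e.
Qed.

(** Layer-cake argument. With the elements of [X] in order of decreasing weight, the new maximum is
    governed by the first one that the edge [p] does not violate. It is thus a constant minus a
    nonnegative combination of the indicators that [p] violates all of an initial segment, and [D]
    is nonpositive on each of these. *)
Lemma max_linear_ge0 (E : Type) (X : finType) (D : (E -> R) -> R)
    (bad : E -> X -> bool) (w : X -> R) (x : X) (hi delta : R) :
  (forall F G, F =1 G -> D F = D G) ->
  (forall a F G, D (fun p => a * F p + G p) = a * D F + D G) ->
  (forall a, D (fun=> a) = 0) ->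
  (forall S : seq X, D (fun p => (all (bad p) S)%:R) <= 0) ->
  0 <= delta ->
  0 <= D (fun p => maxR (fun y => w y + (hi - delta * (bad p y)%:R))).
Proof.
move=> Dext Dlin Dcst Dbad d0.
have [xm Wx Wle] := maxRP w x; set W := maxR w in Wx Wle.
(* A floor for the new maximum: the old maximiser retains at least this value even if violated. Then
   [v] is the unviolated value cut off at the floor, and [U s p] reads off [v] at the first
   unviolated element of [s], or [f] if there is none. *)
pose f := W + (hi - delta).
pose v y := Num.max f (w y + hi).
pose U s p := foldr (fun y u => if bad p y then u else v y) f s.
have vf y : f <= v y by rewrite le_max lexx.
have UfS s p : f <= U s p by elim: s => //= y s IHs; case: ifP.
(* Abel summation along an enumeration of decreasing weight. *)
have abel s S t : sorted (fun y z => v z <= v y) s -> f <= t ->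
    (forall y, y \in s -> v y <= t) ->
    0 <= D (fun p => (all (bad p) S)%:R * (U s p - t)).
  elim: s S t => [|y s IHs] S t.
    move=> _ ft _; rewrite (Dext _ (fun p => (f - t) * (all (bad p) S)%:R + 0)).
      by rewrite Dlin Dcst addr0 mulr_le0// subr_le0.
    by move=> p; rewrite addr0 mulrC.
  move=> sy ft yt.
  (* Here [S] holds the elements already passed and [t] bounds the remaining values. The level drops
     from [t] to [v y] at the cost of a nonpositive multiple of the indicator for [S]; the remainder
     is the same problem with [y] added to [S]. *)
  rewrite (Dext _ (fun p => (v y - t) * (all (bad p) S)%:R
    + (all (bad p) (y :: S))%:R * (U s p - v y))); last first.
    by move=> p /=; case: (bad p y); case: all => /=; ring.
  rewrite Dlin addr_ge0 ?mulr_le0 ?subr_le0 ?yt ?mem_head//.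
  apply: IHs => //; first exact: path_sorted sy.
  move=> z zs; move: sy; rewrite /= path_sortedE; last first.
    by move=> a b c ba ac; apply: le_trans ac ba.
  by case/andP => /allP/(_ z zs).
pose s := sort (fun y z => v z <= v y) (enum X).
have ss : sorted (fun y z => v z <= v y) s by apply: sort_sorted => y z; apply: le_total.
have fhi : f <= W + hi by rewrite lerD2l gerBl.
have vW y : v y <= W + hi by rewrite ge_max fhi lerD2r Wle.
(* [U] takes only the floor or values at unviolated elements, so it is at most the maximum.
   Conversely, a violated maximiser lies below the floor, and an unviolated one is preceded in [s]
   only by elements with at least as large [v]. *)
have Umax p : maxR (fun y => w y + (hi - delta * (bad p y)%:R)) = U s p.
  set u := fun y => _; have [ym ue ule] := maxRP u x; set m := maxR u in ue ule *.
  have fm : f <= m.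
    apply: le_trans (ule xm); rewrite /u -Wx lerD2l lerB//.
    by case: (bad p xm); rewrite ?mulr1 ?mulr0.
  apply/le_anti/andP; split; last first.
    elim: (s) => //= y s' IHs; case: ifP => // by_.
    by rewrite ge_max fm; move: (ule y); rewrite /u by_ mulr0 subr0.
  rewrite ue /u; case: (boolP (bad p ym)) => [_|nb].
    by rewrite mulr1; apply: le_trans (UfS s p); rewrite lerD2r Wle.
  rewrite mulr0 subr0.
  apply: (@le_trans _ _ (v ym)); first by rewrite le_max lexx orbT.
  have: ym \in s by rewrite mem_sort mem_enum.
  move: ss; elim: (s) => //= y s' IHs sy.
  rewrite inE => /orP[/eqP <-|ys]; first by rewrite (negbTE nb).
  case: ifP => _; first by apply: IHs => //; apply: path_sorted sy.
  move: sy; rewrite path_sortedE; last by move=> a b c ba ac; apply: le_trans ac ba.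
  by case/andP => /allP/(_ _ ys).
rewrite (Dext _ (fun p => 1 * ((all (bad p) [::])%:R * (U s p - (W + hi))) + (W + hi))).
  by rewrite Dlin Dcst addr0 mul1r; apply: abel.
by move=> p; rewrite Umax /=; ring.
Qed.

End Maximum.

(** * Replacing a single edge: convexity *)

Section Gain.
Variable R : realType.

Lemma expr_convex (t a b : R) K : 0 <= t <= 1 -> 0 <= a -> 0 <= b ->
  (t * a + (1 - t) * b) ^+ K <= t * a ^+ K + (1 - t) * b ^+ K.
Proof.
case/andP => t0 t1 a0 b0.
have t1' : 0 <= 1 - t by rewrite subr_ge0.
elim: K => [|K IHK]; first by rewrite !expr0; lra.
rewrite exprS; apply: le_trans (ler_wpM2l _ IHK) _.
  by rewrite addr_ge0 ?mulr_ge0.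
rewrite -subr_ge0.
(* The defect left by the induction hypothesis factors, and its last two factors have the same
   sign. *)
have -> : t * a ^+ K.+1 + (1 - t) * b ^+ K.+1
  - (t * a + (1 - t) * b) * (t * a ^+ K + (1 - t) * b ^+ K)
  = t * (1 - t) * ((a - b) * (a ^+ K - b ^+ K)) by rewrite !exprS; ring.
apply: mulr_ge0; first exact: mulr_ge0.
case: (leP a b) => ab.
  by rewrite mulr_le0// subr_le0// lerXn2r.
by rewrite mulr_ge0// ?subr_ge0 ?lerXn2r ?ltW//.
Qed.

Lemma avg_tuple_prod (T : finType) (f : T -> R) K :
  avg (fun t : K.-tuple T => \prod_(j < K) f (tnth t j)) = avg f ^+ K.
Proof. by rewrite /avg sum_tuple_prod card_tuple natrX expr_div_n. Qed.

Variables (n1 n2 K : nat) (L : finType).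
Hypotheses (n1_gt0 : (0 < n1)%N) (n2_gt0 : (0 < n2)%N) (L_gt0 : (0 < #|L|)%N).

Definition hyperedge n := (K.-tuple 'I_n * L)%type.
Definition shiftl (p : hyperedge n1) : hyperedge (n1 + n2) :=
  (map_tuple (@lshift n1 n2) p.1, p.2).
Definition shiftr (p : hyperedge n2) : hyperedge (n1 + n2) :=
  (map_tuple (@rshift n1 n2) p.1, p.2).

Definition ratio : R := n1%:R / (n1 + n2)%:R.

Lemma ratio01 : 0 <= ratio <= 1.
Proof.
rewrite /ratio divr_ge0// ler_pdivrMr ?ltr0n ?addn_gt0 ?n1_gt0//.
by rewrite mul1r ler_nat leq_addr.
Qed.

Lemma ratioC : 1 - ratio = n2%:R / (n1 + n2)%:R.
Proof.
have n0 : (n1 + n2)%:R != 0 :> R by rewrite pnatr_eq0 -lt0n addn_gt0 n1_gt0.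
rewrite /ratio; apply: (mulIf n0); rewrite mulrBl mul1r !mulfVK//.
by rewrite natrD addrAC subrr add0r.
Qed.

Lemma avg_ord_split (f : 'I_(n1 + n2) -> R) :
  avg f = ratio * avg (f \o @lshift n1 n2) + (1 - ratio) * avg (f \o @rshift n1 n2).
Proof.
rewrite ratioC /avg !card_ord big_split_ord/= /ratio.
have h1 : n1%:R != 0 :> R by rewrite pnatr_eq0 -lt0n.
have h2 : n2%:R != 0 :> R by rewrite pnatr_eq0 -lt0n.
have n0 : n1%:R + n2%:R != 0 :> R by rewrite -natrD pnatr_eq0 -lt0n addn_gt0 n1_gt0.
by rewrite natrD; field; rewrite h1 h2 n0.
Qed.

(** The expected loss when a uniform edge is replaced by an edge inside one of the two sides, the
    first chosen with probability [ratio]. *)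
Definition gain (F : hyperedge (n1 + n2) -> R) : R :=
  avg F - (ratio * avg (F \o shiftl) + (1 - ratio) * avg (F \o shiftr)).

Lemma eq_gain F G : F =1 G -> gain F = gain G.
Proof.
move=> e; rewrite /gain (eq_avg e) (eq_avg (G := G \o shiftl)).
  by rewrite (eq_avg (F := F \o shiftr) (G := G \o shiftr))// => p; apply: e.
by move=> p; apply: e.
Qed.

Lemma gain_lin a F G : gain (fun p => a * F p + G p) = a * gain F + gain G.
Proof. by rewrite /gain /comp !avgD !avgZ; ring. Qed.

Lemma card_hyperedge n : (0 < n)%N -> (0 < #|{: hyperedge n}|)%N.
Proof. by move=> n0; rewrite card_prod card_tuple card_ord muln_gt0 expn_gt0 n0. Qed.

Lemma gain_cst a : gain (fun=> a) = 0.
Proof.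
rewrite /gain /comp !avg_cst ?card_hyperedge//; first by ring.
by rewrite addn_gt0 n1_gt0.
Qed.

(** After summation over labels, only membership of all endpoints in a common node class matters.
    The product of indicators makes each term average to a K-th power. *)
Definition class_sum n (P : hyperedge n -> R) : Prop :=
  exists (T : finType) (g : T -> R) (C : T -> pred 'I_n),
    (forall v, 0 <= g v) /\
    forall e, \sum_a P (e, a) = \sum_v g v * \prod_(j < K) (C v (tnth e j))%:R.

(** The node map [h] covers three cases at once: the identity and the two injections of the
    sides. *)
Lemma avg_class_sum n (P : hyperedge n -> R) (U : finType) (g : U -> R) m
    (C : U -> pred 'I_n) (h : 'I_m -> 'I_n) :
  (forall e, \sum_a P (e, a) = \sum_v g v * \prod_(j < K) (C v (tnth e j))%:R) ->
  avg (fun p : hyperedge m => P (map_tuple h p.1, p.2)) =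
  \sum_v (g v / #|L|%:R) * avg (fun i => (C v (h i))%:R) ^+ K.
Proof.
move=> PE; rewrite avg_prod /=.
under eq_avg => e.
  rewrite /avg PE mulr_suml.
  under eq_bigr => v _.
    rewrite mulrAC.
    under eq_bigr => j _ do rewrite tnth_map.
    over.
  over.
rewrite avg_sum; apply: eq_bigr => v _.
by rewrite avgZ (avg_tuple_prod (fun i => (C v (h i))%:R)).
Qed.

(** Term by term: the density of a class in the whole node set is the [ratio]-mixture of its
    densities in the two sides, so [expr_convex] applies. *)
Lemma gain_le0 (P : hyperedge (n1 + n2) -> R) : class_sum P -> gain P <= 0.
Proof.
move=> [T [g [C [g0 PE]]]]; rewrite subr_le0.
rewrite [X in X <= _](eq_avg (G := fun p => P (map_tuple id p.1, p.2))); last first.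
  by move=> [e a] /=; congr (P (_, _)); apply: eq_from_tnth => j; rewrite tnth_map.
rewrite !(avg_class_sum _ PE) !mulr_sumr -big_split/=; apply: ler_sum => v _.
rewrite mulrCA [X in _ + X]mulrCA -mulrDr ler_wpM2l ?divr_ge0//.
rewrite avg_ord_split; apply: expr_convex; first exact: ratio01.
  by rewrite divr_ge0// sumr_ge0.
by rewrite divr_ge0// sumr_ge0.
Qed.

End Gain.

(** * Superadditivity for a general model *)

Section Models.
Variables (R : realType) (Md : model R).
Notation K := (mK Md).
Notation q := (mq Md).
Notation L := (mL Md).
Notation cfg n := {ffun 'I_n -> 'I_q}.

Definition edges n m (G : graph Md n m) : seq (hyperedge K L n) := zip G.1 G.2.

Lemma size_edges n m (G : graph Md n m) : size (edges G) = m.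
Proof. by rewrite size_zip !size_tuple minnn. Qed.

Lemma sum_edges (V : nmodType) n m (G : graph Md n m) (F : hyperedge K L n -> V) :
  \sum_(p <- edges G) F p = \sum_(e < m) F (tnth G.1 e, tnth G.2 e).
Proof.
rewrite /edges -[zip _ _]/(tval (zip_tuple G.1 G.2)) big_tuple.
by apply: eq_bigr => e _; rewrite (tnth_nth (tnth G.1 e, tnth G.2 e)) nth_zip ?size_tuple// -!tnth_nth.
Qed.

Lemma edges_gunion n1 n2 m1 m2 (G1 : graph Md n1 m1) (G2 : graph Md n2 m2) :
  edges (gunion G1 G2) =
  map (@shiftl n1 n2 K L) (edges G1) ++ map (@shiftr n1 n2 K L) (edges G2).
Proof.
rewrite /edges /gunion /= zip_cat ?size_map ?size_tuple//; congr (_ ++ _).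
  by case: G1 => -[s /= _] [t /= _]; elim: s t => [|a s IHs] [|b t]//=; rewrite IHs.
by case: G2 => -[s /= _] [t /= _]; elim: s t => [|a s IHs] [|b t]//=; rewrite IHs.
Qed.

Hypothesis L_gt0 : (0 < #|L|)%N.

Lemma card_graph n m : (0 < n)%N -> (0 < #|graph Md n m|)%N.
Proof.
by move=> n0; rewrite card_prod !card_tuple card_ord muln_gt0 !expn_gt0 n0 L_gt0.
Qed.

Lemma avg_mem_set (T : finType) (P : pred T) :
  avg (fun t => (P t)%:R) = #|[set t | P t]|%:R / #|T|%:R :> R.
Proof.
by rewrite /avg -natr_sum -sum1dep_card [in RHS]big_mkcond/=; congr (_%:R / _);
  apply: eq_bigr => t _; case: (P t).
Qed.

Section TwoParts.
Variables (n1 n2 : nat).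
Hypothesis n1_gt0 : (0 < n1)%N.
Notation theta := (ratio R n1 n2).

(** The interpolation scheme for graphs: nonnegative gain at every state is exactly the one-edge
    comparison, and the binomial expansion yields disjoint unions. *)
Lemma interpolation (St : Type) (add : St -> hyperedge K L (n1 + n2) -> St)
    (phi : St -> R) (s : St) M :
  (forall s e f, add (add s e) f = add (add s f) e) ->
  (forall s, 0 <= gain (fun p => phi (add s p))) ->
  \sum_(m < M.+1) binp M theta m *
    avg (fun G1 : graph Md n1 m => avg (fun G2 : graph Md n2 (M - m) =>
      phi (foldl add s (edges (gunion G1 G2)))))
  <= avg (fun G : graph Md (n1 + n2) M => phi (foldl add s (edges G))).
Proof.
move=> addAC pos.
have le s' : mix add (@shiftl n1 n2 K L) (@shiftr n1 n2 K L) theta phi s'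
    <= step add id phi s' by rewrite -subr_ge0; apply: pos.
have := iter_mix_le addAC (ratio01 R n2 n1_gt0) M le s.
rewrite (iter_mix addAC) (iter_step add id).
under [X in _ <= X -> _]eq_avg do rewrite map_id.
apply: le_trans; rewrite le_eqVlt; apply/orP; left; apply/eqP.
apply: eq_bigr => m _; apply/esym.
rewrite iter_step; congr (_ * _); apply: eq_avg => G1.
by rewrite iter_step; apply: eq_avg => G2; rewrite edges_gunion foldl_cat.
Qed.

End TwoParts.

Variables (i0 : 'I_q) (bad : L -> K.-tuple 'I_q -> bool) (hi delta : R).
Hypothesis delta_ge0 : 0 <= delta.

Definition violated n (p : hyperedge K L n) (x : cfg n) : bool :=
  bad p.2 (map_tuple x p.1).

Hypothesis violated_class : forall n (S : seq (cfg n)),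
  class_sum (fun p => (all (violated p) S)%:R : R).

(** A finite substitute for [Hx]. Only the maxima are required to agree, so that hard constraints
    can be included. *)
Definition weight n m (G : graph Md n m) (x : cfg n) : R :=
  \sum_(i < n) hnode (x i) + \sum_(p <- edges G) (hi - delta * (violated p x)%:R).

Hypothesis HG_weight : forall n m (G : graph Md n m),
  HG G = \big[maxe/-oo%E]_x (weight G x)%:E.

Lemma HG_maxR n m (G : graph Md n m) : HG G = (maxR (weight G))%:E.
Proof. by rewrite HG_weight (bigmaxe_maxR _ [ffun=> i0]). Qed.

Lemma EH_avg n m :
  EH Md n m = (avg (fun G : graph Md n m => maxR (weight G)))%:E.
Proof.
rewrite /EH /avg mulr_suml -sumEFin; apply: eq_bigr => G _.
by rewrite HG_maxR -EFinM mulrC.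
Qed.

Lemma violated_shiftl n1 n2 (p : hyperedge K L n1) (x : cfg (n1 + n2)) :
  violated (shiftl n2 p) x = violated p [ffun i => x (lshift n2 i)].
Proof.
congr (bad _ _); apply: eq_from_tnth => j.
by rewrite !tnth_map ffunE.
Qed.

Lemma violated_shiftr n1 n2 (p : hyperedge K L n2) (x : cfg (n1 + n2)) :
  violated (shiftr n1 p) x = violated p [ffun i => x (rshift n1 i)].
Proof.
congr (bad _ _); apply: eq_from_tnth => j.
by rewrite !tnth_map ffunE.
Qed.

Lemma weight_gunion n1 n2 m1 m2 (G1 : graph Md n1 m1) (G2 : graph Md n2 m2) x :
  weight (gunion G1 G2) x = weight G1 [ffun i => x (lshift n2 i)]
    + weight G2 [ffun i => x (rshift n1 i)].
Proof.
rewrite /weight edges_gunion big_cat !big_map big_split_ord/= addrACA.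
congr (_ + _ + (_ + _)).
- by apply: eq_bigr => i _; rewrite ffunE.
- by apply: eq_bigr => p _; rewrite violated_shiftl.
- by apply: eq_bigr => i _; rewrite ffunE.
- by apply: eq_bigr => p _; rewrite violated_shiftr.
Qed.

Lemma maxR_gunion n1 n2 m1 m2 (G1 : graph Md n1 m1) (G2 : graph Md n2 m2) :
  maxR (weight (gunion G1 G2)) = maxR (weight G1) + maxR (weight G2).
Proof.
have [x1 e1 le1] := maxRP (weight G1) [ffun=> i0].
have [x2 e2 le2] := maxRP (weight G2) [ffun=> i0].
pose x : cfg (n1 + n2) := [ffun i => match split i with inl j => x1 j | inr j => x2 j end].
apply: (maxR_eq (x := x)) => [y|]; first by rewrite weight_gunion lerD.
rewrite weight_gunion e1 e2; congr (_ + _); congr (weight _); apply/ffunP => i.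
  by rewrite !ffunE (unsplitK (inl i)).
by rewrite !ffunE (unsplitK (inr i)).
Qed.

Lemma EH_superadditive n1 n2 M : (0 < n1)%N -> (0 < n2)%N ->
  ((\sum_(m < M.+1) (binp M (ratio R n1 n2) m)%:E * EH Md n1 m)
   + (\sum_(m < M.+1) (binp M (ratio R n1 n2) m)%:E * EH Md n2 (M - m))
   <= EH Md (n1 + n2) M)%E.
Proof.
move=> n1_gt0 n2_gt0.
rewrite -big_split/= EH_avg.
under eq_bigr do rewrite !EH_avg -!EFinM -EFinD -mulrDr.
rewrite sumEFin lee_fin.
(* The state is the whole vector of current weights, indexed by assignments; it starts from the node
   potentials and each edge adds its own potential. *)
pose add (w : {ffun cfg (n1 + n2) -> R}) p :=
  [ffun x => w x + (hi - delta * (violated p x)%:R)].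
have foldE s es x : foldl add s es x =
    s x + \sum_(p <- es) (hi - delta * (violated p x)%:R).
  elim: es s => [|p es IHes] s /=; first by rewrite big_nil addr0.
  by rewrite IHes big_cons addrA ffunE.
pose w0 := [ffun x : cfg (n1 + n2) => \sum_i (hnode (x i) : R)].
have weightE m (G : graph Md (n1 + n2) m) :
    maxR (foldl add w0 (edges G)) = maxR (weight G).
  by apply: eq_maxR => x; rewrite foldE ffunE.
have addAC s e f : add (add s e) f = add (add s f) e.
  by apply/ffunP => x; rewrite !ffunE addrAC.
have pos s : 0 <= gain (fun p => maxR (add s p)).
  rewrite (eq_gain (G := fun p =>
    maxR (fun x => s x + (hi - delta * (violated p x)%:R)))); last first.
    by move=> p; apply: eq_maxR => x; rewrite ffunE.
  apply: (max_linear_ge0 _ [ffun=> i0]) => //.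
  - exact: eq_gain.
  - exact: gain_lin.
  - exact: gain_cst.
  - by move=> S; apply: gain_le0.
have := interpolation (phi := fun w : {ffun _ -> R} => maxR w) n1_gt0 w0 M addAC pos.
under [X in _ <= X]eq_avg do rewrite weightE.
apply: le_trans; rewrite le_eqVlt; apply/orP; left; apply/eqP.
apply: eq_bigr => m _; congr (_ * _).
under [RHS]eq_avg => G1.
  under eq_avg do rewrite weightE maxR_gunion.
  rewrite avgD avg_cst ?card_graph//.
  over.
by rewrite avgD avg_cst ?card_graph.
Qed.

Hypotheses (hnode0 : forall i : 'I_q, hnode i = 0 :> R).
Hypotheses (hi1 : hi = 1) (delta1 : delta = 1).

Lemma weight_count n m (G : graph Md n m) x :
  weight G x = (count (fun p => ~~ violated p x) (edges G))%:R.
Proof.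
rewrite /weight big1 ?add0r// -sum1_count natr_sum [RHS]big_mkcond/= hi1 delta1.
by apply: eq_bigr => p _; case: violated; rewrite /= mul1r ?subrr ?subr0.
Qed.

Lemma HG_sat n m (G : graph Md n m) :
  (HG G == (m%:R)%:E) =
  ([set x | all (fun p => ~~ violated p x) (edges G)] != set0).
Proof.
rewrite HG_maxR; apply/eqP/set0Pn => [[e]|[x]].
  have [x ex _] := maxRP (weight G) [ffun=> i0].
  exists x; rewrite inE all_count size_edges -(eqr_nat R) -weight_count -ex.
  exact/eqP.
rewrite inE all_count size_edges => /eqP e; congr _%:E.
apply: (maxR_eq (x := x)) => [y|]; rewrite weight_count ?e//.
by rewrite ler_nat -[leqRHS](size_edges G) count_size.
Qed.

Lemma psat_superadditive n1 n2 M : (0 < n1)%N -> (0 < n2)%N ->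
  \sum_(m < M.+1) binp M (ratio R n1 n2) m * punion Md n1 n2 m (M - m)
  <= psat Md (n1 + n2) M.
Proof.
move=> n1_gt0 n2_gt0.
(* The state is the set of assignments that violate no edge so far. *)
pose add (S : {set cfg (n1 + n2)}) p := S :&: [set x | ~~ violated p x].
pose phi (S : {set cfg (n1 + n2)}) : R := (S != set0)%:R.
have foldE S es : foldl add S es =
    S :&: [set x | all (fun p => ~~ violated p x) es].
  elim: es S => [|p es IHes] S /=; apply/setP => x; first by rewrite !inE andbT.
  by rewrite IHes !inE andbA.
have phiE m (G : graph Md (n1 + n2) m) :
    phi (foldl add setT (edges G)) = (HG G == (m%:R)%:E)%:R.
  by rewrite foldE setTI HG_sat.
have addAC s e f : add (add s e) f = add (add s f) e.
  by rewrite /add setIAC.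
have pos s : 0 <= gain (fun p => phi (add s p)).
  (* The edge destroys satisfiability exactly when all of [s] violates it. For empty [s] both sides
     are 0, as [all] is then vacuously true. *)
  rewrite (eq_gain (G := fun p => (- 1) * (all (violated p) (enum s))%:R + 1)).
    by rewrite gain_lin gain_cst// addr0 mulN1r oppr_ge0; apply: gain_le0.
  move=> p; rewrite /phi; case: set0Pn => [[x]|H].
    rewrite !inE => /andP[xs nb]; case: allP => [/(_ x)|_] /=; last by rewrite mulr0 add0r.
    by rewrite mem_enum xs (negbTE nb) => /(_ isT).
  case: allP => [_|[]] /=; first by rewrite mulr1 addNr.
  move=> x; rewrite mem_enum => xs; apply/negPn/negP => nb; case: H.
  by exists x; rewrite !inE xs.
have := interpolation (phi := phi) n1_gt0 setT M addAC pos.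
under [X in _ <= X]eq_avg do rewrite phiE.
rewrite avg_mem_set -/(psat _ _ _).
apply: le_trans; rewrite le_eqVlt; apply/orP; left; apply/eqP.
apply: eq_bigr => m _; congr (_ * _).
under [RHS]eq_avg => G1 do under eq_avg do rewrite phiE.
rewrite /punion -natrM -card_prod -avg_mem_set avg_prod.
by apply: eq_avg => G1; apply: eq_avg => G2.
Qed.

End Models.

(** * Node classes for each kind of constraint *)

Lemma sum_unit (V : nmodType) (F : unit -> V) : \sum_u F u = F tt.
Proof. by rewrite (big_pred1 tt)// => -[]. Qed.

Section ClassSums.
Variable R : realType.

Lemma prod_bool K (b : 'I_K -> bool) :
  \prod_(j < K) (b j)%:R = [forall j, b j]%:R :> R.
Proof.
case: forallP => [bT|bF]; first by rewrite big1// => j _; rewrite bT.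
have [j bj] : exists j, ~~ b j.
  by apply/existsP; apply: contraT => /existsPn nb; case: bF => j; apply/negPn.
by rewrite (bigD1 j)//= (negbTE bj) mul0r.
Qed.

(** The fibres of [f] are disjoint, so only the one containing the index [j0] can contribute. *)
Lemma sum_prod_eq (T : finType) K (f : 'I_K -> T) (j0 : 'I_K) :
  \sum_v \prod_(j < K) (f j == v)%:R = [forall j, f j == f j0]%:R :> R.
Proof.
rewrite (bigD1 (f j0))//= prod_bool big1 ?addr0// => v vf.
by rewrite (bigD1 j0)//= eq_sym (negbTE vf) mul0r.
Qed.

Lemma class_sum_setT (L : finType) K n (P : hyperedge K L n -> R) :
  (forall p, P p = 1) -> class_sum P.
Proof.
move=> P1; exists unit, (fun=> #|L|%:R), (fun=> predT); split=> [_|e].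
  exact: ler0n.
rewrite sum_unit prod_bool; under eq_bigr do rewrite P1.
by rewrite sumr_const; case: forallP => [_|[]]; rewrite ?mulr1.
Qed.

Lemma map_tuple_eqP (T U : eqType) (f g : T -> U) (s : seq T) :
  (map_tuple f (in_tuple s) == map_tuple g (in_tuple s)) =
  all (fun x => f x == g x) s.
Proof.
rewrite -val_eqE/=; apply/eqP/allP => [/eq_in_map e x xs|e].
  by rewrite e.
by apply/eq_in_map => x xs; apply/eqP/e.
Qed.

Lemma forall_ord2 (b : 'I_2 -> bool) : [forall j, b j] = b ord0 && b ord_max.
Proof.
apply/forallP/andP => [bT|[b0 b1] j]; first by rewrite !bT.
by have [->|->] : j = ord0 \/ j = ord_max by case: j => -[|[|]]// ?;
  [left|right]; apply: val_inj.
Qed.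

(** The classes are the fibres of the map sending a node to its vector of values under the members
    of [S]. *)
Lemma class_sum_equal q n (S : seq {ffun 'I_n -> 'I_q}) :
  class_sum (fun p : hyperedge 2 unit n =>
    (all (fun x : {ffun 'I_n -> 'I_q} => x0 (map_tuple x p.1) == x1 (map_tuple x p.1)) S)%:R : R).
Proof.
exists ((size S).-tuple 'I_q), (fun=> 1),
  (fun v i => map_tuple (fun x : {ffun 'I_n -> 'I_q} => x i) (in_tuple S) == v).
split=> // e; rewrite sum_unit /=.
under [RHS]eq_bigr do rewrite mul1r.
rewrite (sum_prod_eq (fun j => map_tuple (fun x : {ffun 'I_n -> 'I_q} => x (tnth e j)) (in_tuple S)) ord_max).
rewrite forall_ord2 eqxx andbT map_tuple_eqP; congr (_%:R).
by congr nat_of_bool; apply: eq_all => x; rewrite /x0 /x1 !tnth_map.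
Qed.

Lemma class_sum_ones n (S : seq {ffun 'I_n -> 'I_2}) :
  class_sum (fun p : hyperedge 2 unit n =>
    (all (fun x : {ffun 'I_n -> 'I_2} => (val (x0 (map_tuple x p.1)) == 1%N)
      && (val (x1 (map_tuple x p.1)) == 1%N)) S)%:R : R).
Proof.
exists unit, (fun=> 1), (fun=> fun i => all (fun x : {ffun 'I_n -> 'I_2} => val (x i) == 1%N) S).
split=> // e; rewrite !sum_unit mul1r prod_bool forall_ord2 -all_predI /=.
by congr (nat_of_bool _)%:R; apply: eq_all => x; rewrite /x0 /x1 !tnth_map.
Qed.

Lemma eq_map_tupleE K (T : finType) (U : eqType) (f g : T -> U) (e : K.-tuple T) :
  (map_tuple f e == map_tuple g e) = [forall j, f (tnth e j) == g (tnth e j)].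
Proof.
apply/eqP/forallP => [fg j|fg].
  by have /(congr1 (fun t => tnth t j)) := fg; rewrite !tnth_map => ->.
by apply: eq_from_tnth => j; rewrite !tnth_map; apply/eqP.
Qed.

Lemma class_sum_sat K n (S : seq {ffun 'I_n -> 'I_2}) :
  class_sum (fun p : hyperedge K (K.-tuple 'I_2) n =>
    (all (fun x : {ffun 'I_n -> 'I_2} => map_tuple x p.1 == p.2) S)%:R : R).
Proof.
case: S => [|y S]; first exact: class_sum_setT.
exists unit, (fun=> 1), (fun=> fun i => all (fun x : {ffun 'I_n -> 'I_2} => x i == y i) S).
split=> // e; rewrite sum_unit mul1r prod_bool.
rewrite (bigD1 (map_tuple y e))//= eqxx big1 ?addr0 => [|a /negbTE]; last first.
  by rewrite eq_sym => ->.
congr (nat_of_bool _)%:R; apply/allP/forallP => [yS j|yS x xS].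
  by apply/allP => x /yS; rewrite eq_map_tupleE => /forallP.
by rewrite eq_map_tupleE; apply/forallP => j; have /allP := yS j; apply.
Qed.

Lemma rev_ord2_neq (a b : 'I_2) : (a == rev_ord b) = (a != b).
Proof. by case: a b => -[|[|]]// ? [[|[|]]//]. Qed.

(** On the endpoints each member of [S] must equal the reference [y] or its complement. Hence the
    classes are the fibres of the vector of agreements with [y]; the factor 2 counts the two labels,
    the pattern of [y] and its complement. *)
Lemma class_sum_nae K n (S : seq {ffun 'I_n -> 'I_2}) : (0 < K)%N ->
  class_sum (fun p : hyperedge K (K.-tuple 'I_2) n =>
    (all (fun x : {ffun 'I_n -> 'I_2} => (map_tuple x p.1 == p.2) ||
      (map_tuple x p.1 == map_tuple (@rev_ord 2) p.2)) S)%:R : R).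
Proof.
move=> K0; case: S => [|y S]; first exact: class_sum_setT.
pose j0 := Ordinal K0.
exists ((size S).-tuple bool), (fun=> 2),
  (fun v i => map_tuple (fun x : {ffun 'I_n -> 'I_2} => x i == y i) (in_tuple S) == v).
split=> // e; rewrite -mulr_sumr.
rewrite (sum_prod_eq (fun j => map_tuple (fun x : {ffun 'I_n -> 'I_2} => x (tnth e j) == y (tnth e j)) (in_tuple S)) j0).
set t := map_tuple y e.
set Q := [forall j, _].
have rev2K (a : K.-tuple 'I_2) : map_tuple (@rev_ord 2) (map_tuple (@rev_ord 2) a) = a.
  by apply: eq_from_tnth => j; rewrite !tnth_map rev_ordK.
have QE : Q = all (fun x : {ffun 'I_n -> 'I_2} =>
    (map_tuple x e == t) || (map_tuple x e == map_tuple (@rev_ord 2) t)) S.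
  have tE : map_tuple (@rev_ord 2) t = map_tuple (fun i => rev_ord (y i)) e.
    by apply: eq_from_tnth => j; rewrite !tnth_map.
  apply/forallP/allP => [H x xS|H j].
    have {}H j : (x (tnth e j) == y (tnth e j)) = (x (tnth e j0) == y (tnth e j0)).
      by have := H j; rewrite map_tuple_eqP => /allP/(_ x xS)/eqP.
    rewrite tE !eq_map_tupleE; case: (boolP (x (tnth e j0) == y (tnth e j0))) => e0.
      by apply/orP; left; apply/forallP => j; rewrite H.
    by apply/orP; right; apply/forallP => j; rewrite rev_ord2_neq H.
  rewrite map_tuple_eqP; apply/allP => x /H.
  rewrite tE !eq_map_tupleE => /orP[] /forallP xy; first by rewrite !(eqP (xy _)) !eqxx.
  by have := xy j; have := xy j0; rewrite !rev_ord2_neq => /negbTE-> /negbTE->.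
(* The two labels are distinct because there is at least one coordinate. *)
have nt : map_tuple (@rev_ord 2) t != t.
  apply/eqP => /(congr1 (fun u => tnth u j0)); rewrite tnth_map => /esym/eqP.
  by rewrite rev_ord2_neq eqxx.
rewrite (bigD1 t)//= (bigD1 (map_tuple (@rev_ord 2) t))//= rev2K !eqxx orbT /= big1 ?addr0.
  rewrite -QE.
  under eq_all do rewrite orbC.
  by rewrite -QE mulr_natl mulr2n.
move=> a /andP[ta tra]; rewrite [t == a]eq_sym (negbTE ta) /=.
case: eqP => // tE; case/eqP: tra; rewrite /t tE.
by rewrite rev2K.
Qed.

End ClassSums.

(** * Reduction of the potentials to finite penalties *)

Lemma HG_weight_fin (R : realType) (Md : model R)
    (bad : mL Md -> (mK Md).-tuple 'I_(mq Md) -> bool) (hi delta : R) :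
  (forall a t, hedge a t = (hi - delta * (bad a t)%:R)%:E :> \bar R) ->
  forall n m (G : graph Md n m), HG G = \big[maxe/-oo%E]_x (weight bad hi delta G x)%:E.
Proof.
move=> he n m G; apply: eq_bigr => x _.
rewrite /Hx /weight sum_edges EFinD -!sumEFin; congr (_ + _)%E.
by apply: eq_bigr => e _; rewrite he.
Qed.

Lemma ltn_count (T : eqType) (a b : pred T) (s : seq T) y :
  (forall x, a x -> b x) -> y \in s -> b y -> ~~ a y -> (count a s < count b s)%N.
Proof.
move=> ab ys by_ nay; elim: s ys => //= x s IHs.
have le : (count a s <= count b s)%N by apply: sub_count.
rewrite inE => /orP[/eqP <-|/IHs lt]; first by rewrite by_ (negbTE nay).
have : (a x <= b x)%N by case: (a x) (ab x) => [->|].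
by move=> abx; rewrite -addnS leq_add.
Qed.

Section IndependentSet.
Variable R : realType.
Let Md := model_of (IndSet R).
Let bad (_ : mL Md) (t : (mK Md).-tuple 'I_(mq Md)) :=
  (val (x0 t) == 1%N) && (val (x1 t) == 1%N).

Lemma weight_IndSet n m (G : graph Md n m) x :
  weight bad 0 1 G x =
  \sum_(i < n) (val (x i))%:R - (count (fun p => violated bad p x) (edges G))%:R.
Proof.
rewrite /weight; congr (_ + _); rewrite -sum1_count natr_sum -sumrN [RHS]big_mkcond.
by apply: eq_bigr => p _; rewrite mul1r sub0r; case: violated; rewrite ?oppr0.
Qed.

(** Induction on the number of violated edges: setting the first endpoint of one to 0 loses one unit
    of node weight, repairs that edge and violates no new one. *)
Lemma repair_IndSet n m (G : graph Md n m) x :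
  exists2 y, all (fun p => ~~ violated bad p y) (edges G)
    & weight bad 0 1 G x <= weight bad 0 1 G y.
Proof.
have [k] := ubnP (count (fun p => violated bad p x) (edges G)).
elim: k x => // k IHk x; rewrite ltnS => lek.
case: (boolP (all (fun p => ~~ violated bad p x) (edges G))) => [|/allPn[p pG]].
  by move=> ?; exists x.
move=> /negPn pv; pose i := tnth p.1 ord0.
pose z : {ffun 'I_n -> 'I_2} := [ffun j => if j == i then ord0 else x j].
have zx q : violated bad q z -> violated bad q x.
  rewrite /violated /bad /x0 /x1 !tnth_map !ffunE.
  by do 2 case: ifP => _ //=; rewrite ?andbF.
have pz : ~~ violated bad p z.
  by rewrite /violated /bad /x0 !tnth_map !ffunE eqxx.
have lt := ltn_count zx pG pv pz.
have [y ay le] := IHk z (leq_trans lt lek).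
exists y => //; apply: le_trans le; rewrite !weight_IndSet.
rewrite (bigD1 i)//= [in leRHS](bigD1 i)//=.
have -> : val (x i) = 1%N.
  by move: pv; rewrite /violated /bad /x0 tnth_map => /andP[/eqP].
rewrite [in leRHS]ffunE eqxx add0r.
under [in leRHS]eq_bigr => j /negbTE ji do rewrite ffunE ji.
move: lt; rewrite -(ler_nat R) -addn1 natrD; lra.
Qed.

(* Deleting one endpoint of each violated edge costs at most one unit of weight
   per edge, so the hard constraint can be traded for a unit penalty. *)
Lemma HG_weight_IndSet n m (G : graph Md n m) :
  HG G = \big[maxe/-oo%E]_x (weight bad 0 1 G x)%:E.
Proof.
have HxE x : all (fun p => ~~ violated bad p x) (edges G) ->
    Hx G x = (weight bad 0 1 G x)%:E.
  move=> ax; rewrite /Hx /weight EFinD -!sumEFin sum_edges; congr (_ + _)%E.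
  move: ax; rewrite /edges -[zip _ _]/(tval (zip_tuple G.1 G.2)) => /all_tnthP ax.
  apply: eq_bigr => e _; have := ax e.
  rewrite (tnth_nth (tnth G.1 e, tnth G.2 e)) nth_zip ?size_tuple// -!tnth_nth.
  move=> nv; rewrite (negbTE nv) mulr0 subr0.
  by move: nv; rewrite /violated /bad/= => /negbTE ->.
apply/le_anti/andP; split; apply: bigmax_le => [|x _]; rewrite ?leNye//; last first.
  have [y ay le] := repair_IndSet G x.
  by apply: (@le_trans _ _ (Hx G y)); [rewrite HxE// lee_fin | exact: le_bigmax].
case: (boolP (all (fun p => ~~ violated bad p x) (edges G))) => [/HxE->|].
  exact: (le_bigmax _ (fun y => (weight bad 0 1 G y)%:E)).
rewrite /edges -[zip _ _]/(tval (zip_tuple G.1 G.2)) -has_predC => /has_tnthP[e /=].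
rewrite (tnth_nth (tnth G.1 e, tnth G.2 e)) nth_zip ?size_tuple// -!tnth_nth.
move=> /negPn; rewrite /violated/= => bv.
rewrite /Hx (bigD1 e)//= [X in (_ + (X + _))%E](_ : _ = -oo%E).
  by rewrite addNye addeNy leNye.
by move: bv; rewrite /bad => ->.
Qed.

End IndependentSet.

(** * The six models *)

Theorem theorem5 (R : realType) (c : R) (k : kind R) (N1 N2 : nat) :
  0 < c -> kind_ok k -> (1 <= N1)%N -> (1 <= N2)%N ->
  let Md := model_of k in
  let N := (N1 + N2)%N in
  let M := Num.truncn (c * N%:R) in
  ((\sum_(m1 < M.+1) (binp M (N1%:R / N%:R) m1)%:E * EH Md N1 m1)
   + (\sum_(m1 < M.+1) (binp M (N1%:R / N%:R) m1)%:E * EH Md N2 (M - m1))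
   <= EH Md N M)%E
  /\ (is_csp k ->
      \sum_(m1 < M.+1) binp M (N1%:R / N%:R) m1 * punion Md N1 N2 m1 (M - m1)
      <= psat Md N M).
Proof.
move=> _ ok N1_gt0 N2_gt0 Md N M; rewrite {}/Md.
have unit_gt0 : (0 < #|{: unit}|)%N by rewrite card_unit.
have signs_gt0 K : (0 < #|{: K.-tuple 'I_2}|)%N by rewrite card_tuple card_ord expn_gt0.
have cut n (x y : 'I_n) : ((x != y)%:R)%:E = (1 - 1 * (x == y)%:R)%:E :> \bar R.
  by case: eqP; rewrite ?mulr1 ?subrr ?mulr0 ?subr0.
have sat b : (if b then 0%E else 1%E) = (1 - 1 * b%:R)%:E :> \bar R.
  by case: b; rewrite ?mulr1 ?subrr ?mulr0 ?subr0.
case: k ok => [||beta B|q|K|K] ok.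
- split=> //.
  apply: (EH_superadditive (Md := model_of (IndSet R)) unit_gt0 ord0 ler01 _
    (@HG_weight_IndSet R) M N1_gt0 N2_gt0) => n S.
  exact: class_sum_ones.
- split=> //.
  have hedgeE a t : hedge (m := model_of (MaxCut R)) a t =
      (1 - 1 * (x0 t == x1 t)%:R)%:E by exact: cut.
  apply: (EH_superadditive (Md := model_of (MaxCut R)) unit_gt0 ord0 ler01 _
    (HG_weight_fin hedgeE) M N1_gt0 N2_gt0) => n S.
  exact: class_sum_equal.
- split=> //.
  (* An edge with equal spins drops from [beta] to [- beta], so the penalty is twice [beta]. *)
  have beta2_ge0 : 0 <= beta * 2 by rewrite mulr_ge0// ltW.
  have hedgeE a t : hedge (m := model_of (Ising beta B)) a t =
      (beta - beta * 2 * (x0 t == x1 t)%:R)%:E.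
    have ising b : (if b then - beta else beta) = beta - beta * 2 * b%:R.
      by case: b => /=; ring.
    by congr _%:E; apply: ising.
  apply: (EH_superadditive (Md := model_of (Ising beta B)) unit_gt0 ord0
    beta2_ge0 _ (HG_weight_fin hedgeE) M N1_gt0 N2_gt0) => n S.
  exact: class_sum_equal.
- have q_gt0 : (0 < q)%N by apply: ltn_trans ok.
  have cl n (S : seq {ffun 'I_n -> 'I_q}) := class_sum_equal R S.
  have hedgeE a t : hedge (m := model_of (Coloring R q)) a t =
      (1 - 1 * (x0 t == x1 t)%:R)%:E by exact: cut.
  have HGE := HG_weight_fin hedgeE.
  split=> [|_].
    exact: (EH_superadditive (Md := model_of (Coloring R q)) unit_gt0
      (Ordinal q_gt0) ler01 cl HGE M N1_gt0 N2_gt0).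
  by apply: (psat_superadditive (Md := model_of (Coloring R q)) unit_gt0
    (Ordinal q_gt0) cl HGE _ _ _ M N1_gt0 N2_gt0).
- have cl n (S : seq {ffun 'I_n -> 'I_2}) := class_sum_sat R K S.
  have hedgeE a t : hedge (m := model_of (KSAT R K)) a t =
      (1 - 1 * (t == a)%:R)%:E by exact: sat.
  have HGE := HG_weight_fin hedgeE.
  split=> [|_].
    exact: (EH_superadditive (Md := model_of (KSAT R K)) (signs_gt0 K)
      ord0 ler01 cl HGE M N1_gt0 N2_gt0).
  by apply: (psat_superadditive (Md := model_of (KSAT R K)) (signs_gt0 K)
    ord0 cl HGE _ _ _ M N1_gt0 N2_gt0).
- have cl n (S : seq {ffun 'I_n -> 'I_2}) := class_sum_nae R S (ltnW ok).
  have hedgeE a t : hedge (m := model_of (NAESAT R K)) a t =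
      (1 - 1 * ((t == a) || (t == map_tuple (@rev_ord 2) a))%:R)%:E by exact: sat.
  have HGE := HG_weight_fin hedgeE.
  split=> [|_].
    exact: (EH_superadditive (Md := model_of (NAESAT R K)) (signs_gt0 K)
      ord0 ler01 cl HGE M N1_gt0 N2_gt0).
  by apply: (psat_superadditive (Md := model_of (NAESAT R K)) (signs_gt0 K)
    ord0 cl HGE _ _ _ M N1_gt0 N2_gt0).
Qed.
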